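(* Let $p:\mathscr{E}\to\mathscr{B}$ be a functor with a comprehension structure with section $([-],\star)$ in $\mathbf{Cat}$, where $\mathscr{B}$ and $\mathscr{E}$ are equipped with endofunctors $F:\mathscr{B}\to\mathscr{B}$ and $G:\mathscr{E}\to\mathscr{E}$. There is a one-to-one correspondence between the liftings to $\mathbf{Endo}(\mathbf{Cat})$ of the comprehension structure with section $([-],\star)$ and the pairs of natural transformations (distributivity laws) $$\delta:F\circ p\Rightarrow p\circ G:\mathscr{E}\to\mathscr{B},\qquad \sigma:G\circ\star\Rightarrow\star\circ F:\mathscr{B}\to\mathscr{E}$$ such that (1) the composite natural transformation $F=F\circ p\circ\star\xRightarrow{\ \delta\circ\star\ }p\circ G\circ\star\xRightarrow{\ p\circ\sigma\ }p\circ\star\circ F=F$ is the identity, and (2) the natural transformation $\sigma$ is invertible.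
   Context: A section of a 1-cell $p:\mathbf{E}\to\mathbf{B}$ in a 2-category $\mathscr{K}$ is a 1-cell $\star:\mathbf{B}\to\mathbf{E}$ with $p\circ\star=\mathrm{id}_{\mathbf{B}}$. A comprehension structure with section on $p$ in $\mathscr{K}$ is a section $\star$ of $p$ together with a right adjoint $[-]:\mathbf{E}\to\mathbf{B}$ of $\star$ in $\mathscr{K}$ (with specified unit and counit). The 2-category $\mathbf{Endo}(\mathbf{Cat})$ has: objects the pairs $(\mathscr{C},H)$ of a category $\mathscr{C}$ and an endofunctor $H:\mathscr{C}\to\mathscr{C}$; 1-cells $(\mathscr{C}_1,H_1)\to(\mathscr{C}_2,H_2)$ the pairs $(f,\varphi)$ of a functor $f:\mathscr{C}_1\to\mathscr{C}_2$ and a natural transformation (distributivity law) $\varphi:H_2\circ f\Rightarrow f\circ H_1$, composed by pasting; 2-cells $(f,\varphi)\Rightarrow(g,\psi)$ the natural transformations $\theta:f\Rightarrow g$ such that $(\theta\circ H_1)\cdot\varphi=\psi\cdot(H_2\circ\theta)$. There is a forgetful 2-functor $\mathbf{Endo}(\mathbf{Cat})\to\mathbf{Cat}$, $(\mathscr{C},H)\mapsto\mathscr{C}$. A lifting to $\mathbf{Endo}(\mathbf{Cat})$ of the comprehension structure with section $([-],\star)$ on $p$ consists of a 1-cell $(p,\delta):(\mathscr{E},G)\to(\mathscr{B},F)$ of $\mathbf{Endo}(\mathbf{Cat})$ together with a comprehension structure with section on it in $\mathbf{Endo}(\mathbf{Cat})$, given by a section $(\star,\sigma):(\mathscr{B},F)\to(\mathscr{E},G)$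 and a right adjoint $([-],\tau):(\mathscr{E},G)\to(\mathscr{B},F)$, such that the forgetful 2-functor to $\mathbf{Cat}$ sends these data to the given $p$, $\star$, $[-]$ and the given unit and counit of $\star\dashv[-]$. The correspondence sends such a lifting to the pair $(\delta,\sigma)$. *)

(* Defs.v *)
(* Equality of morphisms, functors and 2-cells is Leibniz equality, made
   extensional by functional extensionality and proof irrelevance. *)
From mathcomp Require Import ssreflect ssrfun.
From Stdlib Require Import FunctionalExtensionality ProofIrrelevance.

Set Implicit Arguments.
Unset Strict Implicit.
Unset Printing Implicit Defensive.

(* The identity arrow of a reflexive type-valued relation, seen as an arrow
   between propositionally equal points. *)
Definition idto (T : Type) (H : T -> T -> Type) (i : forall x, H x x)
    (x y : T) (e : x = y) : H x y :=
  match e in _ = z return H x z with eq_refl => i x end.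

Lemma idto_irr (T : Type) (H : T -> T -> Type) (i : forall x, H x x)
    (x : T) (e : x = x) : idto i e = i x.
Proof. by rewrite (proof_irrelevance _ e eq_refl). Qed.

(* [comp1 g f] is g o f, [vcomp b a] is "a, then b", and [hcomp b a] is the
   horizontal composite of a : f => f' followed by b : g => g'.
   Composition of 1-cells is strictly associative and unital; as these are
   propositional equalities, the laws of horizontal composition that relate
   2-cells with equal but not convertible boundaries are stated with the
   identity 2-cells [idto id2 e] between equal 1-cells. *)
Record twocat := TwoCat {
  cell0 : Type;
  cell1 : cell0 -> cell0 -> Type;
  cell2 : forall a b, cell1 a b -> cell1 a b -> Type;
  id1 : forall a, cell1 a a;
  comp1 : forall a b c, cell1 b c -> cell1 a b -> cell1 a c;
  id2 : forall a b (f : cell1 a b), cell2 f f;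
  vcomp : forall a b (f g h : cell1 a b), cell2 g h -> cell2 f g -> cell2 f h;
  hcomp : forall a b c (f f' : cell1 a b) (g g' : cell1 b c),
    cell2 g g' -> cell2 f f' -> cell2 (comp1 g f) (comp1 g' f');
  comp1_idl : forall a b (f : cell1 a b), comp1 (id1 b) f = f;
  comp1_idr : forall a b (f : cell1 a b), comp1 f (id1 a) = f;
  comp1A : forall a b c d (h : cell1 c d) (g : cell1 b c) (f : cell1 a b),
    comp1 h (comp1 g f) = comp1 (comp1 h g) f;
  vcomp_idl : forall a b (f g : cell1 a b) (u : cell2 f g),
    vcomp (id2 g) u = u;
  vcomp_idr : forall a b (f g : cell1 a b) (u : cell2 f g),
    vcomp u (id2 f) = u;
  vcompA : forall a b (f g h k : cell1 a b)
      (w : cell2 h k) (v : cell2 g h) (u : cell2 f g),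
    vcomp w (vcomp v u) = vcomp (vcomp w v) u;
  hcomp_id2 : forall a b c (f : cell1 a b) (g : cell1 b c),
    hcomp (id2 g) (id2 f) = id2 (comp1 g f);
  interchange : forall a b c (f f' f'' : cell1 a b) (g g' g'' : cell1 b c)
      (v' : cell2 g' g'') (v : cell2 g g') (u' : cell2 f' f'') (u : cell2 f f'),
    hcomp (vcomp v' v) (vcomp u' u) = vcomp (hcomp v' u') (hcomp v u);
  hcomp_idl : forall a b (f f' : cell1 a b) (u : cell2 f f'),
    vcomp (idto (@id2 _ _) (comp1_idl f')) (hcomp (id2 (id1 b)) u)
    = vcomp u (idto (@id2 _ _) (comp1_idl f));
  hcomp_idr : forall a b (f f' : cell1 a b) (u : cell2 f f'),
    vcomp (idto (@id2 _ _) (comp1_idr f')) (hcomp u (id2 (id1 a)))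
    = vcomp u (idto (@id2 _ _) (comp1_idr f));
  hcompA : forall a b c d (h h' : cell1 c d) (g g' : cell1 b c)
      (f f' : cell1 a b) (w : cell2 h h') (v : cell2 g g') (u : cell2 f f'),
    vcomp (idto (@id2 _ _) (comp1A h' g' f')) (hcomp w (hcomp v u))
    = vcomp (hcomp (hcomp w v) u) (idto (@id2 _ _) (comp1A h g f))
}.

Arguments id1 {_} a.
Arguments id2 {_ _ _} f.

Definition eq2 (K : twocat) (a b : cell0 K) (f g : cell1 a b) (e : f = g) :
  cell2 f g := idto (@id2 K a b) e.

Declare Scope twocat_scope.
Delimit Scope twocat_scope with K.
Notation "g \o1 f" := (comp1 g f)
  (at level 40, left associativity) : twocat_scope.
Notation "v \v u" := (vcomp v u)
  (at level 50, left associativity) : twocat_scope.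
Notation "v \h u" := (hcomp v u)
  (at level 40, left associativity) : twocat_scope.
Local Open Scope twocat_scope.

Definition invertible2 (K : twocat) (a b : cell0 K) (f g : cell1 a b)
    (u : cell2 f g) : Prop :=
  exists v : cell2 g f, v \v u = id2 f /\ u \v v = id2 g.

(* The triangle identities are pasted along
   l = l o 1 => l o (r o l) = (l o r) o l => 1 o l = l  and
   r = 1 o r => (r o l) o r = r o (l o r) => r o 1 = r. *)
Record adjunction (K : twocat) (a b : cell0 K) (l : cell1 a b) (r : cell1 b a) :=
  Adjunction {
  unit2 : cell2 (id1 a) (r \o1 l);
  counit2 : cell2 (l \o1 r) (id1 b);
  triangle_l :
    eq2 (comp1_idl l) \v (counit2 \h id2 l) \v eq2 (comp1A l r l)
      \v (id2 l \h unit2) \v eq2 (eq_sym (comp1_idr l)) = id2 l;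
  triangle_r :
    eq2 (comp1_idr r) \v (id2 r \h counit2) \v eq2 (eq_sym (comp1A r l r))
      \v (unit2 \h id2 r) \v eq2 (eq_sym (comp1_idl r)) = id2 r
}.

Record section1 (K : twocat) (e b : cell0 K) (p : cell1 e b) := Section1 {
  sec1 :> cell1 b e;
  sec1K : p \o1 sec1 = id1 b
}.

Record comprehension (K : twocat) (e b : cell0 K) (p : cell1 e b) :=
  Comprehension {
  star : section1 p;
  brackets : cell1 e b;
  star_adj : adjunction star brackets
}.

Record twofunctor (K L : twocat) := TwoFunctor {
  tf0 :> cell0 K -> cell0 L;
  tf1 : forall a b, cell1 a b -> cell1 (tf0 a) (tf0 b);
  tf2 : forall a b (f g : cell1 a b), cell2 f g -> cell2 (tf1 f) (tf1 g);
  tf1_id : forall a, tf1 (id1 a) = id1 (tf0 a);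
  tf1_comp : forall a b c (g : cell1 b c) (f : cell1 a b),
    tf1 (g \o1 f) = tf1 g \o1 tf1 f;
  tf2_id : forall a b (f : cell1 a b), tf2 (id2 f) = id2 (tf1 f);
  tf2_vcomp : forall a b (f g h : cell1 a b) (v : cell2 g h) (u : cell2 f g),
    tf2 (v \v u) = tf2 v \v tf2 u;
  tf2_hcomp : forall a b c (g g' : cell1 b c) (f f' : cell1 a b)
      (v : cell2 g g') (u : cell2 f f'),
    eq2 (tf1_comp g' f') \v tf2 (v \h u)
    = (tf2 v \h tf2 u) \v eq2 (tf1_comp g f)
}.

Section SectionComposite.
Variables (K : twocat) (e b : cell0 K) (p : cell1 e b) (s : section1 p).
Variables (F : cell1 b b) (G : cell1 e e).

Lemma section_source : F = F \o1 p \o1 s.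
Proof. by rewrite -comp1A sec1K comp1_idr. Qed.

Lemma section_target : p \o1 (s \o1 F) = F.
Proof. by rewrite comp1A sec1K comp1_idl. Qed.

(* F = (F o p) o s => (p o G) o s = p o (G o s) => p o (s o F) = F. *)
Definition section_composite
    (delta : cell2 (F \o1 p) (p \o1 G)) (sigma : cell2 (G \o1 s) (s \o1 F)) :
    cell2 F F :=
  eq2 section_target \v (id2 p \h sigma) \v eq2 (eq_sym (comp1A p G s))
    \v (delta \h id2 (sec1 s)) \v eq2 section_source.
End SectionComposite.

Section Eq2.
Variable K : twocat.

Lemma eq2_irr (a b : cell0 K) (f : cell1 a b) (e : f = f) : eq2 e = id2 f.
Proof. exact: idto_irr. Qed.

Lemma eq2_trans (a b : cell0 K) (f g h : cell1 a b) (e : f = g) (e' : g = h) :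
  eq2 e' \v eq2 e = eq2 (eq_trans e e').
Proof. by case: _ / e'; case: _ / e; rewrite /eq2 /= vcomp_idl. Qed.

Lemma eq2_trans_r (a b : cell0 K) (f g h k : cell1 a b) (u : cell2 h k)
    (e : f = g) (e' : g = h) :
  u \v eq2 e' \v eq2 e = u \v eq2 (eq_trans e e').
Proof. by rewrite -vcompA eq2_trans. Qed.

Lemma hcomp_eq2 (a b c : cell0 K) (f f' : cell1 a b) (g g' : cell1 b c)
    (e : f = f') (e' : g = g') :
  eq2 e' \h eq2 e = eq2 (f_equal2 (@comp1 K a b c) e' e).
Proof. by case: _ / e; case: _ / e'; rewrite !eq2_irr hcomp_id2. Qed.

Lemma whisker_l (a b c : cell0 K) (l : cell1 b c) (f g h : cell1 a b)
    (v : cell2 g h) (u : cell2 f g) :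
  id2 l \h (v \v u) = (id2 l \h v) \v (id2 l \h u).
Proof. by rewrite -interchange vcomp_idl. Qed.

Lemma whisker_r (a b c : cell0 K) (l : cell1 a b) (f g h : cell1 b c)
    (v : cell2 g h) (u : cell2 f g) :
  (v \v u) \h id2 l = (v \h id2 l) \v (u \h id2 l).
Proof. by rewrite -interchange vcomp_idl. Qed.
End Eq2.

Section MapComprehension.
Variables (K L : twocat) (U : twofunctor K L).

Lemma tf2_eq2 (a b : cell0 K) (f g : cell1 a b) (e : f = g) :
  tf2 U (eq2 e) = eq2 (f_equal (@tf1 K L U a b) e).
Proof. by case: _ / e; rewrite /eq2 /= tf2_id. Qed.

Lemma tf2_hcompE (a b c : cell0 K) (g g' : cell1 b c) (f f' : cell1 a b)
      (v : cell2 g g') (u : cell2 f f') :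
  tf2 U (v \h u)
  = eq2 (eq_sym (tf1_comp U g' f')) \v (tf2 U v \h tf2 U u)
      \v eq2 (tf1_comp U g f).
Proof.
by rewrite -vcompA -tf2_hcomp vcompA eq2_trans eq2_irr vcomp_idl.
Qed.

Variables (a b : cell0 K) (l : cell1 a b) (r : cell1 b a).
Variable A : adjunction l r.

Definition map_unit2 : cell2 (id1 (U a)) (tf1 U r \o1 tf1 U l) :=
  eq2 (tf1_comp U r l) \v tf2 U (unit2 A) \v eq2 (eq_sym (tf1_id U a)).

Definition map_counit2 : cell2 (tf1 U l \o1 tf1 U r) (id1 (U b)) :=
  eq2 (tf1_id U b) \v tf2 U (counit2 A) \v eq2 (eq_sym (tf1_comp U l r)).

Lemma map_triangle_l :
  eq2 (comp1_idl (tf1 U l)) \v (map_counit2 \h id2 (tf1 U l))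
    \v eq2 (comp1A (tf1 U l) (tf1 U r) (tf1 U l))
    \v (id2 (tf1 U l) \h map_unit2) \v eq2 (eq_sym (comp1_idr (tf1 U l)))
  = id2 (tf1 U l).
Proof.
rewrite -tf2_id -[in RHS](triangle_l A) !tf2_vcomp !tf2_eq2 !tf2_hcompE !tf2_id.
rewrite /map_unit2 /map_counit2 !whisker_l !whisker_r.
rewrite -[id2 (tf1 U l)]/(eq2 (erefl (tf1 U l))) !hcomp_eq2.
rewrite !vcompA !eq2_trans !eq2_trans_r.
by do ![congr (_ \v _)]; congr eq2; apply: proof_irrelevance.
Qed.

Lemma map_triangle_r :
  eq2 (comp1_idr (tf1 U r)) \v (id2 (tf1 U r) \h map_counit2)
    \v eq2 (eq_sym (comp1A (tf1 U r) (tf1 U l) (tf1 U r)))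
    \v (map_unit2 \h id2 (tf1 U r)) \v eq2 (eq_sym (comp1_idl (tf1 U r)))
  = id2 (tf1 U r).
Proof.
rewrite -tf2_id -[in RHS](triangle_r A) !tf2_vcomp !tf2_eq2 !tf2_hcompE !tf2_id.
rewrite /map_unit2 /map_counit2 !whisker_l !whisker_r.
rewrite -[id2 (tf1 U r)]/(eq2 (erefl (tf1 U r))) !hcomp_eq2.
rewrite !vcompA !eq2_trans !eq2_trans_r.
by do ![congr (_ \v _)]; congr eq2; apply: proof_irrelevance.
Qed.

Definition map_adjunction : adjunction (tf1 U l) (tf1 U r) :=
  Adjunction map_triangle_l map_triangle_r.
End MapComprehension.

Definition map_section (K L : twocat) (U : twofunctor K L) (e b : cell0 K)
    (p : cell1 e b) (s : section1 p) : section1 (tf1 U p) :=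
  @Section1 L (U e) (U b) (tf1 U p) (tf1 U s)
    (eq_trans (eq_sym (tf1_comp U p s))
       (eq_trans (f_equal (@tf1 K L U b b) (sec1K s)) (tf1_id U b))).

Definition map_comprehension (K L : twocat) (U : twofunctor K L)
    (e b : cell0 K) (p : cell1 e b) (c : comprehension p) :
    comprehension (tf1 U p) :=
  @Comprehension L (U e) (U b) (tf1 U p) (map_section U (star c))
    (tf1 U (brackets c)) (map_adjunction U (star_adj c)).

Record category := Category {
  obj :> Type;
  hom : obj -> obj -> Type;
  idm : forall x, hom x x;
  compm : forall x y z, hom y z -> hom x y -> hom x z;
  comp1m : forall x y (f : hom x y), compm (idm y) f = f;
  compm1 : forall x y (f : hom x y), compm f (idm x) = f;
  compmA : forall x y z t (h : hom z t) (g : hom y z) (f : hom x y),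
    compm h (compm g f) = compm (compm h g) f
}.
Arguments idm {_} x.

Declare Scope hom_scope.
Delimit Scope hom_scope with hom.
Notation "g \m f" := (compm g f)
  (at level 40, left associativity) : hom_scope.
Local Open Scope hom_scope.

#[projections(primitive)]
Record functor (C D : category) := Functor {
  fobj :> C -> D;
  fmap : forall x y, hom x y -> hom (fobj x) (fobj y);
  fmap1 : forall x, fmap (idm x) = idm (fobj x);
  fmapM : forall x y z (g : hom y z) (f : hom x y),
    fmap (g \m f) = fmap g \m fmap f
}.

#[projections(primitive)]
Record nattrans (C D : category) (f g : functor C D) := NatTrans {
  ntc :> forall x, hom (f x) (g x);
  natural : forall x y (u : hom x y), ntc y \m fmap f u = fmap g u \m ntc x
}.

Lemma nattrans_eq (C D : category) (f g : functor C D) (u v : nattrans f g) :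
  (forall x, u x = v x) -> u = v.
Proof.
case: u => u nu; case: v => v nv /= e.
have {}e : u = v by apply: functional_extensionality_dep.
by case: _ / e in nv *; rewrite (proof_irrelevance _ nu nv).
Qed.

Lemma functor_irr (C D : category) (f g : functor C D) :
  existT (fun o : C -> D => forall x y, hom x y -> hom (o x) (o y))
    (fobj f) (fmap f)
  = existT (fun o : C -> D => forall x y, hom x y -> hom (o x) (o y))
    (fobj g) (fmap g) -> f = g.
Proof.
move=> e.
pose P (s : {o : C -> D & forall x y, hom x y -> hom (o x) (o y)}) :=
  forall (f1 : forall x, projT2 s x x (idm x) = idm (projT1 s x))
    (fM : forall x y z (g : hom y z) (f : hom x y),
      projT2 s x z (g \m f) = projT2 s y z g \m projT2 s x y f),
    f = Functor f1 fM.
suff: P (existT (fun o : C -> D => forall x y, hom x y -> hom (o x) (o y))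
    (fobj g) (fmap g)).
  by apply.
case: _ / e => f1 fM.
by rewrite (proof_irrelevance _ f1 (@fmap1 _ _ f))
           (proof_irrelevance _ fM (@fmapM _ _ f)).
Qed.

Definition idfun1 (C : category) : functor C C :=
  @Functor C C (fun x => x) (fun _ _ u => u)
    (fun=> erefl) (fun _ _ _ _ _ => erefl).

Definition compfun (C D E : category) (g : functor D E) (f : functor C D) :
  functor C E.
Proof.
refine (@Functor C E (fun x => g (f x)) (fun _ _ u => fmap g (fmap f u)) _ _).
- by move=> x; rewrite !fmap1.
- by move=> x y z v u; rewrite !fmapM.
Defined.

Definition idnat (C D : category) (f : functor C D) : nattrans f f.
Proof.
by refine (@NatTrans C D f f (fun x => idm (f x)) _) => x y u /=;
   rewrite comp1m compm1.
Defined.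

Definition compnat (C D : category) (f g h : functor C D)
  (v : nattrans g h) (u : nattrans f g) : nattrans f h.
Proof.
by refine (@NatTrans C D f h (fun x => v x \m u x) _) => x y w /=;
   rewrite -compmA (natural u) !compmA (natural v).
Defined.

Definition hcompnat (C D E : category) (f f' : functor C D)
  (g g' : functor D E) (v : nattrans g g') (u : nattrans f f') :
  nattrans (compfun g f) (compfun g' f').
Proof.
refine (@NatTrans C E (compfun g f) (compfun g' f')
          (fun x => v (f' x) \m fmap g (u x)) _) => x y w /=.
by rewrite -compmA -fmapM (natural u) fmapM !compmA (natural v).
Defined.

Lemma compfun_idl (C D : category) (f : functor C D) :
  compfun (idfun1 D) f = f.
Proof. exact: functor_irr. Qed.

Lemma compfun_idr (C D : category) (f : functor C D) :
  compfun f (idfun1 C) = f.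
Proof. exact: functor_irr. Qed.

Lemma compfunA (A B C D : category) (h : functor C D) (g : functor B C)
  (f : functor A B) : compfun h (compfun g f) = compfun (compfun h g) f.
Proof. exact: functor_irr. Qed.

Lemma idto_nat (C D : category) (f g : functor C D) (e : f = g) (x : C) :
  (idto (@idnat C D) e : nattrans f g) x
  = idto (@idm D) (f_equal (fun h : functor C D => h x) e).
Proof. by case: _ / e. Qed.

Definition Cat : twocat.
Proof.
refine (@TwoCat category functor nattrans idfun1 compfun idnat compnat hcompnat
          compfun_idl compfun_idr compfunA _ _ _ _ _ _ _ _).
- by move=> C D f g u; apply: nattrans_eq => x /=; rewrite comp1m.
- by move=> C D f g u; apply: nattrans_eq => x /=; rewrite compm1.
- by move=> C D f g h k w v u; apply: nattrans_eq => x /=; rewrite compmA.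
- by move=> C D E f g; apply: nattrans_eq => x /=; rewrite comp1m fmap1.
- move=> C D E f f' f'' g g' g'' v' v u' u; apply: nattrans_eq => x /=.
  by rewrite fmapM -!compmA; congr (_ \m _); rewrite !compmA (natural v).
- move=> C D f f' u; apply: nattrans_eq => x /=.
  by rewrite !idto_nat !idto_irr !comp1m compm1.
- move=> C D f f' u; apply: nattrans_eq => x /=.
  by rewrite !idto_nat !idto_irr !fmap1 !comp1m.
- move=> A B C D h h' g g' f f' w v u; apply: nattrans_eq => x /=.
  by rewrite !idto_nat !idto_irr fmapM comp1m compm1 compmA.
Defined.

Record endo := Endo { ecat :> category; efun : functor ecat ecat }.

Record endo1 (X Y : endo) := Endo1 {
  e1fun :> functor X Y;
  e1law : nattrans (compfun (efun Y) e1fun) (compfun e1fun (efun X))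
}.

Record endo2 (X Y : endo) (f g : endo1 X Y) := Endo2 {
  e2nat :> nattrans f g;
  e2lawP :
    compnat (hcompnat e2nat (idnat (efun X))) (e1law f)
    = compnat (e1law g) (hcompnat (idnat (efun Y)) e2nat)
}.

Lemma endo2_eq (X Y : endo) (f g : endo1 X Y) (u v : endo2 f g) :
  e2nat u = e2nat v -> u = v.
Proof.
case: u => u nu; case: v => v nv /= e; case: _ / e in nv *.
by rewrite (proof_irrelevance _ nu nv).
Qed.

Lemma endo2_lawE (X Y : endo) (f g : endo1 X Y) (u : nattrans f g) :
  (forall x, u (efun X x) \m e1law f x = e1law g x \m fmap (efun Y) (u x)) <->
  compnat (hcompnat u (idnat (efun X))) (e1law f)
  = compnat (e1law g) (hcompnat (idnat (efun Y)) u).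
Proof.
split=> [e|e x].
  by apply: nattrans_eq => x /=; rewrite fmap1 compm1 comp1m; apply: e.
have := f_equal (fun n : nattrans _ _ => n x) e.
by rewrite /= fmap1 compm1 comp1m.
Qed.

Definition id_endo1 (X : endo) : endo1 X X.
Proof.
refine (@Endo1 X X (idfun1 X) (@NatTrans X X
  (compfun (efun X) (idfun1 X)) (compfun (idfun1 X) (efun X)) (fun x => idm (efun X x)) _)).
by move=> x y u /=; rewrite comp1m compm1.
Defined.

(* Pasting: H3 g f => g H2 f => g f H1. *)
Definition comp_endo1 (X Y Z : endo) (g : endo1 Y Z) (f : endo1 X Y) :
  endo1 X Z.
Proof.
refine (@Endo1 X Z (compfun g f)
  (@NatTrans X Z (compfun (efun Z) (compfun g f))
    (compfun (compfun g f) (efun X)) (fun x => fmap g (e1law f x) \m e1law g (f x)) _)).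
move=> x y u /=; rewrite -compmA.
by rewrite (natural (e1law g) (fmap f u)) /= !compmA -!fmapM (natural (e1law f)).
Defined.

(* The two underlying functors differ only in the proofs of functoriality. *)
Lemma endo1_irr (X Y : endo) (o : X -> Y) (m : forall x y, hom x y -> hom (o x) (o y))
    f1 fM f1' fM' (u : nattrans (compfun (efun Y) (@Functor X Y o m f1 fM))
                         (compfun (@Functor X Y o m f1 fM) (efun X)))
    (u' : nattrans (compfun (efun Y) (@Functor X Y o m f1' fM'))
                         (compfun (@Functor X Y o m f1' fM') (efun X))) :
  (forall x, u x = u' x) -> Endo1 u = Endo1 u'.
Proof.
move: u u'; rewrite (proof_irrelevance _ f1' f1) (proof_irrelevance _ fM' fM).
by move=> u u' e; congr Endo1; apply: nattrans_eq.
Qed.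

Lemma comp_endo1_idl (X Y : endo) (f : endo1 X Y) :
  comp_endo1 (id_endo1 Y) f = f.
Proof. by case: f => f u; apply: endo1_irr => x /=; rewrite compm1. Qed.

Lemma comp_endo1_idr (X Y : endo) (f : endo1 X Y) :
  comp_endo1 f (id_endo1 X) = f.
Proof. by case: f => f u; apply: endo1_irr => x /=; rewrite fmap1 comp1m. Qed.

Lemma comp_endo1A (X Y Z T : endo) (h : endo1 Z T) (g : endo1 Y Z)
    (f : endo1 X Y) :
  comp_endo1 h (comp_endo1 g f) = comp_endo1 (comp_endo1 h g) f.
Proof. by apply: endo1_irr => x /=; rewrite fmapM compmA. Qed.

Definition id_endo2 (X Y : endo) (f : endo1 X Y) : endo2 f f.
Proof.
refine (@Endo2 X Y f f (idnat f) _); apply/endo2_lawE => x /=.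
by rewrite fmap1 comp1m compm1.
Defined.

Definition comp_endo2 (X Y : endo) (f g h : endo1 X Y)
  (v : endo2 g h) (u : endo2 f g) : endo2 f h.
Proof.
refine (@Endo2 X Y f h (compnat v u) _); apply/endo2_lawE => x /=.
have /endo2_lawE/(_ x) eu := e2lawP u; have /endo2_lawE/(_ x) ev := e2lawP v.
by rewrite -compmA eu compmA ev fmapM compmA.
Defined.

Definition hcomp_endo2 (X Y Z : endo) (f f' : endo1 X Y) (g g' : endo1 Y Z)
  (v : endo2 g g') (u : endo2 f f') :
  endo2 (comp_endo1 g f) (comp_endo1 g' f').
Proof.
refine (@Endo2 X Z (comp_endo1 g f) (comp_endo1 g' f') (hcompnat v u) _).
apply/endo2_lawE => x /=.
have /endo2_lawE/(_ x) eu := e2lawP u.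
have /endo2_lawE/(_ (f' x)) ev := e2lawP v.
have nu := natural (e1law g) (u x); rewrite /= in nu.
have nv := natural v (e1law f' x); rewrite /= in nv.
rewrite fmapM !compmA -[in RHS](compmA (fmap g' _)) -ev !compmA -nv.
by rewrite -!compmA nu !compmA -(compmA _ (fmap g (e1law f' x))) -fmapM -eu
           fmapM !compmA.
Defined.

Lemma idto_endo (X Y : endo) (f g : endo1 X Y) (e : f = g) :
  e2nat (idto (@id_endo2 X Y) e : endo2 f g)
  = idto (@idnat X Y) (f_equal (@e1fun X Y) e).
Proof. by case: _ / e. Qed.

Definition EndoCat : twocat.
Proof.
refine (@TwoCat endo endo1 endo2 id_endo1 comp_endo1 id_endo2 comp_endo2
          hcomp_endo2 comp_endo1_idl comp_endo1_idr comp_endo1A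
          _ _ _ _ _ _ _ _).
- by move=> *; apply: endo2_eq; apply: (@vcomp_idl Cat).
- by move=> *; apply: endo2_eq; apply: (@vcomp_idr Cat).
- by move=> *; apply: endo2_eq; apply: (@vcompA Cat).
- by move=> *; apply: endo2_eq; apply: (@hcomp_id2 Cat).
- by move=> *; apply: endo2_eq; apply: (@interchange Cat).
- move=> X Y f f' u; apply: endo2_eq; rewrite /= !idto_endo.
  rewrite (proof_irrelevance _ (f_equal (@e1fun X Y) (comp_endo1_idl f'))
             (compfun_idl f')).
  rewrite (proof_irrelevance _ (f_equal (@e1fun X Y) (comp_endo1_idl f))
             (compfun_idl f)).
  exact: (@hcomp_idl Cat).
- move=> X Y f f' u; apply: endo2_eq; rewrite /= !idto_endo.
  rewrite (proof_irrelevance _ (f_equal (@e1fun X Y) (comp_endo1_idr f'))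
             (compfun_idr f')).
  rewrite (proof_irrelevance _ (f_equal (@e1fun X Y) (comp_endo1_idr f))
             (compfun_idr f)).
  exact: (@hcomp_idr Cat).
- move=> X Y Z T h h' g g' f f' w v u; apply: endo2_eq; rewrite /= !idto_endo.
  rewrite (proof_irrelevance _ (f_equal (@e1fun X T) (comp_endo1A h' g' f'))
             (compfunA h' g' f')).
  rewrite (proof_irrelevance _ (f_equal (@e1fun X T) (comp_endo1A h g f))
             (compfunA h g f)).
  exact: (@hcompA Cat).
Defined.

Definition forget : twofunctor EndoCat Cat.
Proof.
refine (@TwoFunctor EndoCat Cat ecat e1fun e2nat
          (fun=> erefl) (fun _ _ _ _ _ => erefl)
          (fun _ _ _ => erefl) (fun _ _ _ _ _ _ _ => erefl) _).
by move=> *; rewrite !eq2_irr vcomp_idl vcomp_idr.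
Defined.

(* A lifting to Endo(Cat): the 1-cell over p is (p, delta) by construction;
   [lift_forget] says that the forgetful 2-functor sends the section, the right
   adjoint, the unit and the counit of [lift_compr] to those of [c]. *)
Record lifting (E B : category) (p : functor E B)
    (c : @comprehension Cat E B p) (F : functor B B) (G : functor E E) :=
  Lifting {
  lift_delta : nattrans (compfun F p) (compfun p G);
  lift_compr :
    @comprehension EndoCat (Endo G) (Endo F)
      (@Endo1 (Endo G) (Endo F) p lift_delta);
  lift_forget : map_comprehension forget lift_compr = c
}.

(* Main.v *)
(* In Endo(Cat) a 1-cell (f, phi) has a right adjoint over a given right adjoint
   of f exactly when phi is invertible, and the law of the right adjoint is then
   the mate of the inverse of phi; in particular it is unique.  Applied to the
   section (star, sigma), this makes tau redundant and turns its existence into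
   condition (2).  Condition (1) is the equation (p, delta) o (star, sigma) = id
   of 1-cells of Endo(Cat), transported along p o star = id. *)
Require Import Defs.
From mathcomp Require Import ssreflect ssrfun.
From Stdlib Require Import ProofIrrelevance IndefiniteDescription.

Set Implicit Arguments.
Unset Strict Implicit.
Unset Printing Implicit Defensive.

Local Open Scope twocat_scope.
Local Open Scope hom_scope.

(** * Bijections, identity arrows and equality of bundled structures *)

(** [bijective] asks for an inverse function: indefinite description picks a preimage of each point,
    and injectivity makes the choice a two-sided inverse. *)
Lemma inj_surj_bij (S T : Type) (f : S -> T) :
  injective f -> (forall t, exists s, f s = t) -> bijective f.
Proof.
move=> injf surjf.
pose g t := proj1_sig (constructive_indefinite_description _ (surjf t)).
have gK : cancel g f.
  by move=> t; rewrite /g; case: constructive_indefinite_description.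
by exists g => // s; apply: injf; rewrite gK.
Qed.

Lemma fmap_idto (C D : category) (f : functor C D) (x y : C) (e : x = y) :
  fmap f (idto (@idm C) e) = idto (@idm D) (f_equal (fobj f) e).
Proof. by case: _ / e => /=; rewrite fmap1. Qed.

Lemma idto_symK (C : category) (x y : C) (e : x = y) (e' : y = x) :
  idto (@idm C) e \m idto (@idm C) e' = idm y.
Proof. by case: _ / e in e' *; rewrite !idto_irr comp1m. Qed.

Lemma adjunction_eq (K : twocat) (a b : cell0 K) (l : cell1 a b)
    (r : cell1 b a) (A A' : adjunction l r) :
  unit2 A = unit2 A' -> counit2 A = counit2 A' -> A = A'.
Proof.
case: A => u k tl tr; case: A' => u' k' tl' tr' /= eu ek.
case: _ / eu in tl' tr' *; case: _ / ek in tl' tr' *.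
by rewrite (proof_irrelevance _ tl tl') (proof_irrelevance _ tr tr').
Qed.

Lemma section1_eq (K : twocat) (e b : cell0 K) (p : cell1 e b)
    (s s' : section1 p) : sec1 s = sec1 s' -> s = s'.
Proof.
case: s => s sK; case: s' => s' sK' /= es; case: _ / es in sK' *.
by rewrite (proof_irrelevance _ sK sK').
Qed.

(** The types of [A] and [A'] depend on [r] and [r'], hence the dependent pairs; [inj_pair2] strips
    off the common section [s]. *)
Lemma comprehension_inj (K : twocat) (e b : cell0 K) (p : cell1 e b)
    (s : section1 p) (r r' : cell1 e b) (A : adjunction s r)
    (A' : adjunction s r') :
  Comprehension A = Comprehension A' ->
  existT (fun r => adjunction s r) r A = existT (fun r => adjunction s r) r' A'.
Proof.
move=> eA.
pose f (c : comprehension p) := existT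
  (fun s : section1 p => {r : cell1 e b & adjunction s r})
  (star c) (existT _ (brackets c) (star_adj c)).
exact: inj_pair2 (f_equal f eA).
Qed.

(** * 1-cells of Endo(Cat) and condition (1) *)

(** The two laws have different types. Instead of transporting one along [e], the criterion asks
    that the identity transformation along [e] satisfy the equation of a 2-cell of [EndoCat]. *)
Lemma endo1_eqP (X Y : endo) (f g : endo1 X Y) (e : e1fun f = e1fun g) :
  f = g <->
  forall x, (idto (@idnat X Y) e : nattrans f g) (efun X x) \m e1law f x
    = e1law g x \m fmap (efun Y) ((idto (@idnat X Y) e : nattrans f g) x).
Proof.
split=> [efg|].
  case: _ / efg in e * => x.
  by rewrite idto_irr /= fmap1 comp1m compm1.
case: f g e => [f u] [g v] /= e; case: _ / e in v * => /= H.
by congr Endo1; apply: nattrans_eq => x; have := H x; rewrite fmap1 comp1m compm1.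
Qed.

Lemma endo1_law_inj (X Y : endo) (f : functor X Y)
    (u v : nattrans (compfun (efun Y) f) (compfun f (efun X))) :
  Endo1 u = Endo1 v -> u = v.
Proof.
pose law (g : endo1 X Y) := existT
  (fun f : functor X Y => nattrans (compfun (efun Y) f) (compfun f (efun X)))
  (e1fun g) (e1law g).
move=> e; exact: inj_pair2 (f_equal law e).
Qed.

(** At [x], the composite of condition (1) is the pasted law followed by [i (F x)] and preceded by
    [F] of the inverse of [i x]. Cancelling the invertible arrow [fmap F (i x)] turns it into the
    square of [endo1_eqP]. *)
Lemma section_compositeP (E B : category) (p : functor E B)
    (s : @section1 Cat E B p) (F : functor B B) (G : functor E E)
    (delta : nattrans (compfun F p) (compfun p G))
    (sigma : nattrans (compfun G (sec1 s)) (compfun (sec1 s) F)) :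
  @section_composite Cat E B p s F G delta sigma = idnat F <->
  comp_endo1 (@Endo1 (Endo G) (Endo F) p delta)
    (@Endo1 (Endo F) (Endo G) (sec1 s) sigma) = id_endo1 (Endo F).
Proof.
have eP := @endo1_eqP (Endo F) (Endo F)
  (comp_endo1 (@Endo1 (Endo G) (Endo F) p delta)
    (@Endo1 (Endo F) (Endo G) (sec1 s) sigma)) (id_endo1 (Endo F)) (sec1K s).
rewrite {}eP; set sc := (X in X = idnat F); rewrite /=.
set i := idto (@idnat B B) (sec1K s : compfun p (sec1 s) = idfun1 B).
have sE x : (sc : nattrans F F) x
  = i (F x) \m (fmap p (sigma x) \m delta (sec1 s x))
      \m fmap F (idto (@idm B)
          (f_equal (fun h : functor B B => h x) (eq_sym (sec1K s)))).
  rewrite /sc /section_composite /eq2 /= /i !idto_nat fmap_idto.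
  rewrite idto_irr !fmap1 comp1m !compm1 !compmA.
  congr (_ \m _); last by congr idto; apply: proof_irrelevance.
  by do 2 congr (_ \m _); congr idto; apply: proof_irrelevance.
split=> [e x|H].
- have := sE x; rewrite e /= comp1m => e'.
  rewrite -[LHS]compm1 -[fmap F (i x)]comp1m e' -!compmA -fmapM.
  by rewrite {3}/i idto_nat idto_symK fmap1.
- apply: nattrans_eq => x; rewrite sE H comp1m -fmapM /i idto_nat idto_symK.
  exact: fmap1.
Qed.

(** * Pointwise form of adjunctions and invertible 2-cells in Cat *)

(** The coherence 2-cells join functors with the same object map, so by proof irrelevance their
    components are identities. *)
Lemma adjunction_catP (C D : category) (l : functor C D) (r : functor D C)
    (u : nattrans (idfun1 C) (compfun r l))
    (k : nattrans (compfun l r) (idfun1 D)) :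
  ((@eq2 Cat C D _ _ (@comp1_idl Cat C D l)
      \v (@hcomp Cat C D D l l _ _ k (idnat l))
      \v @eq2 Cat C D _ _ (@comp1A Cat C D C D l r l)
      \v (@hcomp Cat C C D _ _ l l (idnat l) u)
      \v @eq2 Cat C D _ _ (eq_sym (@comp1_idr Cat C D l)))%K = idnat l
    <-> forall x, k (l x) \m fmap l (u x) = idm (l x)) /\
  ((@eq2 Cat D C _ _ (@comp1_idr Cat D C r)
      \v (@hcomp Cat D D C _ _ r r (idnat r) k)
      \v @eq2 Cat D C _ _ (eq_sym (@comp1A Cat D C D C r l r))
      \v (@hcomp Cat D C C r r _ _ u (idnat r))
      \v @eq2 Cat D C _ _ (eq_sym (@comp1_idl Cat D C r)))%K = idnat r
    <-> forall y, fmap r (k y) \m u (r y) = idm (r y)).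
Proof.
split; split=> [e x|H].
- have := f_equal (fun n : nattrans _ _ => n x) e.
  by rewrite /= /eq2 !idto_nat !idto_irr !fmap1 !comp1m !compm1.
- apply: nattrans_eq => x.
  by rewrite /= /eq2 !idto_nat !idto_irr !fmap1 !comp1m !compm1; apply: H.
- have := f_equal (fun n : nattrans _ _ => n x) e.
  by rewrite /= /eq2 !idto_nat !idto_irr /= ?fmap1 !comp1m !compm1.
- apply: nattrans_eq => x.
  by rewrite /= /eq2 !idto_nat !idto_irr /= ?fmap1 !comp1m !compm1; apply: H.
Qed.

Lemma invertible2_catP (C D : category) (f g : functor C D)
    (u : nattrans f g) :
  @invertible2 Cat C D f g u ->
  exists v : nattrans g f,
    (forall x, v x \m u x = idm (f x)) /\ (forall x, u x \m v x = idm (g x)).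
Proof.
case=> v [vu uv]; exists v; split=> x.
- exact: (f_equal (fun n : nattrans f f => n x) vu).
- exact: (f_equal (fun n : nattrans g g => n x) uv).
Qed.

(** * Adjunctions in Endo(Cat) and the laws of the two adjoints *)

Section EndoAdjunction.
Variables (X Y : endo) (l : endo1 X Y) (r : endo1 Y X).
Variable A : @adjunction EndoCat X Y l r.

Local Notation u := (e2nat (unit2 A)).
Local Notation k := (e2nat (counit2 A)).

Lemma endo_triangle_l x : k (l x) \m fmap l (u x) = idm (l x).
Proof.
apply: (proj1 (proj1 (adjunction_catP u k))).
have := f_equal (@e2nat _ _ _ _) (triangle_l A).
rewrite /= /eq2 !idto_endo /= => e; rewrite -[RHS]e.
(* Both sides paste the same cells and differ only in the equality proofs inside the coherence
   cells. *)
by do 4 ?[congr (compnat _ _)] => //; congr idto; apply: proof_irrelevance.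
Qed.

Lemma endo_triangle_r y : fmap r (k y) \m u (r y) = idm (r y).
Proof.
apply: (proj1 (proj2 (adjunction_catP u k))).
have := f_equal (@e2nat _ _ _ _) (triangle_r A).
rewrite /= /eq2 !idto_endo /= => e; rewrite -[RHS]e.
by do 4 ?[congr (compnat _ _)] => //; congr idto; apply: proof_irrelevance.
Qed.

Lemma endo_unit_law x :
  fmap r (e1law l x) \m e1law r (l x) \m fmap (efun X) (u x) = u (efun X x).
Proof. by have /endo2_lawE/(_ x) /= <- := e2lawP (unit2 A); rewrite compm1. Qed.

Lemma endo_counit_law y :
  k (efun Y y) \m fmap l (e1law r y) \m e1law l (r y) = fmap (efun Y) (k y).
Proof.
have /endo2_lawE/(_ y) /= := e2lawP (counit2 A).
by rewrite comp1m compmA.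
Qed.

Lemma map_unit2_forget : map_unit2 forget A = u.
Proof.
by apply: nattrans_eq => x; rewrite /map_unit2 /eq2 /= comp1m compm1.
Qed.

Lemma map_counit2_forget : map_counit2 forget A = k.
Proof.
by apply: nattrans_eq => x; rewrite /map_counit2 /eq2 /= comp1m compm1.
Qed.

Lemma left_adjoint_law_invertible :
  @invertible2 Cat X Y (compfun (efun Y) l) (compfun l (efun X)) (e1law l).
Proof.
have nt x y (f : hom x y) := natural (e1law r) f.
have nk x y (f : hom x y) := natural k f.
have ns x y (f : hom x y) := natural (e1law l) f.
have nu x y (f : hom x y) := natural u f.
rewrite /= in nt nk ns nu.
(* The inverse is the mate of the law of [r]: with [H = efun X] and [H' = efun Y], it is
   [l H => l H r l => l r H' l => H' l]. *)
unshelve eexists (@NatTrans X Y (compfun l (efun X)) (compfun (efun Y) l)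
  (fun x => k (efun Y (l x)) \m fmap l (e1law r (l x))
              \m fmap l (fmap (efun X) (u x))) _).
  move=> x y f /=; rewrite -!compmA -!fmapM nu (fmapM (efun X)) [_ \m (_ \m _)]compmA nt.
  by rewrite -compmA fmapM [LHS]compmA nk compmA.
(* One order uses the counit law, the other the unit law; both end with the triangle identity of
   [l]. *)
split; apply: nattrans_eq => x /=.
- by rewrite -compmA -ns compmA endo_counit_law -fmapM endo_triangle_l fmap1.
- by rewrite !compmA -nk -!compmA -!fmapM !compmA endo_unit_law endo_triangle_l.
Qed.

(** Expanding [fmap (efun Y) (k y)] by the counit law puts [e1law l] next to its right inverse [v].
    Once they cancel, naturality of the unit and the triangle identity of [r] leave [e1law r]. *)
Lemma right_adjoint_lawE
    (v : nattrans (compfun l (efun X)) (compfun (efun Y) l)) :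
  (forall x, e1law l x \m v x = idm (l (efun X x))) ->
  forall y, e1law r y
    = fmap r (fmap (efun Y) (k y)) \m fmap r (v (r y)) \m u (efun X (r y)).
Proof.
move=> lv y; rewrite -endo_counit_law -(fmapM r) /= -[_ \m v _]compmA lv.
rewrite compm1 fmapM -compmA.
have /= <- := natural u (e1law r y).
by rewrite compmA endo_triangle_r comp1m.
Qed.
End EndoAdjunction.

(** * Uniqueness of liftings *)

(** A 2-cell of Endo(Cat) is determined by its underlying transformation, which settles unit and
    counit. The laws agree because [right_adjoint_lawE] expresses both through the same inverse
    [v]. *)
Lemma right_adjoint_eq (X Y : endo) (l : endo1 X Y) (r r' : endo1 Y X)
    (A : @adjunction EndoCat X Y l r) (A' : @adjunction EndoCat X Y l r') :
  existT (fun r => @adjunction Cat X Y l r) (e1fun r) (map_adjunction forget A)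
  = existT (fun r => @adjunction Cat X Y l r) (e1fun r')
      (map_adjunction forget A') ->
  existT (fun r => @adjunction EndoCat X Y l r) r A = existT _ r' A'.
Proof.
case: r r' A A' => [r t] [r' t'] A A' /= eA.
have er : r = r' := f_equal (@projT1 _ _) eA.
case: _ / er in t' A' eA *.
move: (inj_pair2 _ _ _ _ _ eA) => {}eA.
have eu : e2nat (unit2 A) = e2nat (unit2 A').
  by rewrite -!map_unit2_forget; apply: (f_equal (@unit2 Cat X Y l r) eA).
have ek : e2nat (counit2 A) = e2nat (counit2 A').
  by rewrite -!map_counit2_forget; apply: (f_equal (@counit2 Cat X Y l r) eA).
have [v [_ lv]] := invertible2_catP (left_adjoint_law_invertible A).
have et : t = t'.
  apply: nattrans_eq => y.
  have /= -> := right_adjoint_lawE A lv y.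
  by have /= -> := right_adjoint_lawE A' lv y; rewrite eu ek.
case: _ / et in A' eA eu ek *; congr existT.
by apply: adjunction_eq; apply: endo2_eq.
Qed.

(** The forgetful 2-functor erases the law of the section, so the sections are compared in [EndoCat]
    itself; the rest is [right_adjoint_eq]. *)
Lemma comprehension_forget_inj (X Y : endo) (p : endo1 X Y)
    (c c' : @comprehension EndoCat X Y p) :
  sec1 (star c) = sec1 (star c') ->
  map_comprehension forget c = map_comprehension forget c' -> c = c'.
Proof.
case: c c' => [s r A] [s' r' A'] /= /(@section1_eq EndoCat X Y p s s') es.
case: _ / es in A' * => /comprehension_inj/right_adjoint_eq e.
exact: (f_equal (fun a => Comprehension (projT2 a)) e).
Qed.

Lemma lifting_eq (E B : category) (p : functor E B)
    (c : @comprehension Cat E B p) (F : functor B B) (G : functor E E)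
    (L L' : lifting c F G) :
  lift_delta L = lift_delta L' ->
  sec1 (star (lift_compr L)) = sec1 (star (lift_compr L')) -> L = L'.
Proof.
case: L L' => [d C e] [d' C' e'] /= ed; case: _ / ed in C' e' * => es.
have eC : C = C' by apply: comprehension_forget_inj; rewrite // e e'.
by case: _ / eC in es e' *; rewrite (proof_irrelevance _ e e').
Qed.

(** * Existence of liftings *)

Lemma adjunction_endo_lift (X Y : endo) (l : endo1 X Y) (r : functor Y X)
    (A : @adjunction Cat X Y l r) :
  @invertible2 Cat X Y (compfun (efun Y) l) (compfun l (efun X)) (e1law l) ->
  exists (t : nattrans (compfun (efun X) r) (compfun r (efun Y)))
         (A' : @adjunction EndoCat X Y l (@Endo1 Y X r t)),
    map_adjunction forget A' = A.
Proof.
case: A => u k tl tr /invertible2_catP[v [vl lv]].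
have tl' := proj1 (proj1 (adjunction_catP u k)) tl.
have nk x y (f : hom x y) := natural k f.
have nu x y (f : hom x y) := natural u f.
have nv x y (f : hom x y) := natural v f.
rewrite /= in nk nu nv.
have nt x y (f : hom x y) :
    fmap r (fmap (efun Y) (k y)) \m fmap r (v (r y)) \m u (efun X (r y))
      \m fmap (efun X) (fmap r f)
    = fmap r (fmap (efun Y) f) \m
      (fmap r (fmap (efun Y) (k x)) \m fmap r (v (r x)) \m u (efun X (r x))).
  rewrite -compmA nu !compmA -!fmapM -!compmA; congr (fmap r _ \m _).
  by rewrite nv !compmA -!fmapM nk.
(* The mate of the inverse [v], which is the only candidate by [right_adjoint_lawE]. *)
pose t := @NatTrans Y X (compfun (efun X) r) (compfun r (efun Y))
  (fun y => fmap r (fmap (efun Y) (k y)) \m fmap r (v (r y))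
              \m u (efun X (r y))) nt.
(* The unit equation cancels [e1law l] after [v], the counit equation below [v] after [e1law l];
   both use the first triangle identity. *)
have Hu : compnat (hcompnat u (idnat (efun X))) (e1law (id_endo1 X))
    = compnat (e1law (comp_endo1 (@Endo1 Y X r t) l))
        (hcompnat (idnat (efun X)) u).
  apply: (proj1 (@endo2_lawE X X (id_endo1 X)
    (comp_endo1 (@Endo1 Y X r t) l) u)) => x /=.
  rewrite compm1 -!compmA nu !compmA -!fmapM -!compmA.
  rewrite nv (compmA (fmap _ _) (fmap _ _)) -fmapM tl' fmap1 comp1m.
  by rewrite lv fmap1 comp1m.
have Hk : compnat (hcompnat k (idnat (efun Y)))
      (e1law (comp_endo1 l (@Endo1 Y X r t)))
    = compnat (e1law (id_endo1 Y)) (hcompnat (idnat (efun Y)) k).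
  apply: (proj1 (@endo2_lawE Y Y (comp_endo1 l (@Endo1 Y X r t))
    (id_endo1 Y) k)) => y /=.
  rewrite comp1m -!fmapM fmapM !compmA nk -!compmA.
  by rewrite (compmA (k _)) tl' comp1m vl compm1.
unshelve eexists t, (@Adjunction EndoCat X Y l (@Endo1 Y X r t)
  (@Endo2 X X (id_endo1 X) (comp_endo1 (@Endo1 Y X r t) l) u Hu)
  (@Endo2 Y Y (comp_endo1 l (@Endo1 Y X r t)) (id_endo1 Y) k Hk) _ _).
- apply: endo2_eq; rewrite /= /eq2 !idto_endo -[RHS]tl /=.
  by do 4 ?[congr (compnat _ _)] => //; congr idto; apply: proof_irrelevance.
- apply: endo2_eq; rewrite /= /eq2 !idto_endo -[RHS]tr /=.
  by do 4 ?[congr (compnat _ _)] => //; congr idto; apply: proof_irrelevance.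
by apply: adjunction_eq; [apply: map_unit2_forget | apply: map_counit2_forget].
Qed.

Lemma lifting_exists (E B : category) (p : functor E B)
    (c : @comprehension Cat E B p) (F : functor B B) (G : functor E E)
    (delta : nattrans (compfun F p) (compfun p G))
    (sigma : nattrans (compfun G (sec1 (star c))) (compfun (sec1 (star c)) F)) :
  @section_composite Cat E B p (star c) F G delta sigma = idnat F ->
  @invertible2 Cat B E _ _ sigma ->
  exists L : lifting c F G, lift_delta L = delta /\
    sec1 (star (lift_compr L)) = @Endo1 (Endo F) (Endo G) (sec1 (star c)) sigma.
Proof.
case: c sigma => [[s ps] r A] sigma /section_compositeP sK isig.
have [t [A' eA]] :=
  @adjunction_endo_lift (Endo F) (Endo G)
    (@Endo1 (Endo F) (Endo G) s sigma) r A isig.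
(* Condition (1), in the form [sK], is exactly the section equation in [EndoCat]. *)
pose s' := @Section1 EndoCat (Endo G) (Endo F)
  (@Endo1 (Endo G) (Endo F) p delta) _ sK.
have eC : map_comprehension forget (@Comprehension EndoCat _ _ _ s' _ A')
    = Comprehension A.
  rewrite /map_comprehension /= eA.
  (* The image of [s'] carries its own proof that [p] after [s] is the identity; it is identified
     with [ps]. *)
  exact: (f_equal (fun e => @Comprehension Cat E B p
    (@Section1 Cat E B p s e) r A) (proof_irrelevance _ _ _)).
by exists (Lifting eC).
Qed.

(** * The law of the section of a lifting *)

(** [lift_forget] matches the underlying section with the given one only propositionally, so its law
    has to be transported. *)
Definition law_over (X Y : endo) (f : endo1 X Y) (g : functor X Y)
    (e : e1fun f = g) : nattrans (compfun (efun Y) g) (compfun g (efun X)) :=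
  match e in _ = g return nattrans (compfun (efun Y) g) (compfun g (efun X))
  with eq_refl => e1law f end.

Lemma law_overE (X Y : endo) (f : endo1 X Y) (g : functor X Y)
    (e : e1fun f = g) : f = Endo1 (law_over e).
Proof. by case: _ / e; case: f. Qed.

Section LiftingLaws.
Variables (E B : category) (p : functor E B) (c : @comprehension Cat E B p).
Variables (F : functor B B) (G : functor E E) (L : lifting c F G).

Definition lift_sigma :
    nattrans (compfun G (sec1 (star c))) (compfun (sec1 (star c)) F) :=
  @law_over (Endo F) (Endo G) (sec1 (star (lift_compr L))) (sec1 (star c))
    (f_equal (fun c => sec1 (star c)) (lift_forget L)).

Lemma lift_sigmaE :
  sec1 (star (lift_compr L))
  = @Endo1 (Endo F) (Endo G) (sec1 (star c)) lift_sigma.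
Proof. exact: law_overE. Qed.

Lemma lift_laws :
  @section_composite Cat E B p (star c) F G (lift_delta L) lift_sigma = idnat F
  /\ @invertible2 Cat B E _ _ lift_sigma.
Proof.
split.
  by apply/section_compositeP; rewrite -lift_sigmaE; apply: (sec1K (star (lift_compr L))).
(* After the rewriting, the law of the left adjoint is literally [lift_sigma]. *)
have A := star_adj (lift_compr L); rewrite lift_sigmaE in A.
exact: left_adjoint_law_invertible A.
Qed.
End LiftingLaws.

Theorem proposition28 (E B : category) (p : functor E B)
    (c : @comprehension Cat E B p) (F : functor B B) (G : functor E E) :
  exists h : lifting c F G ->
      {ds : nattrans (compfun F p) (compfun p G)
            * nattrans (compfun G (sec1 (star c))) (compfun (sec1 (star c)) F)
       | @section_composite Cat E B p (star c) F G ds.1 ds.2 = idnat F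
         /\ @invertible2 Cat B E _ _ ds.2},
    bijective h
    /\ forall L : lifting c F G,
         lift_delta L = (proj1_sig (h L)).1
         /\ sec1 (star (lift_compr L))
            = @Endo1 (Endo F) (Endo G) (sec1 (star c)) (proj1_sig (h L)).2.
Proof.
exists (fun L => exist _ (lift_delta L, lift_sigma L) (lift_laws L)).
split=> [|L]; last by split; last exact: lift_sigmaE.
apply: inj_surj_bij => [L L' /(f_equal (@proj1_sig _ _)) /= e|].
  have [ed es] : lift_delta L = lift_delta L' /\ lift_sigma L = lift_sigma L'.
    by split; [apply: (f_equal fst e) | apply: (f_equal snd e)].
  by apply: lifting_eq => //; rewrite !lift_sigmaE es.
case=> [[d s] H]; have [sK isig] := H.
have [L [eL es]] := lifting_exists sK isig.
rewrite lift_sigmaE in es; have {}es := endo1_law_inj es.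
(* The proof [lift_laws L] is generalized first, since its type mentions the laws being
   rewritten. *)
exists L; move: (lift_laws L); rewrite eL es => HL.
by rewrite (proof_irrelevance _ HL H).
Qed.
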